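(* Let $W$ be a Coxeter group with a chosen Coxeter system $(W,S)$. Then $W$ is a generalized Coxeter group, i.e. there exists a weighted 2-complex $C$ such that $G(C)\cong W$.
   Context: $\mathbb N$ denotes the positive integers. A Coxeter group is a group $W$ admitting a presentation $W=\langle s_1,\dots,s_n \mid (s_is_j)^{m_{ij}}=1\rangle$ with $m_{ij}\in\mathbb N\cup\{\infty\}$, $m_{ij}\ge 2$ for $i\ne j$, $m_{ii}=1$; the pair $(W,S)$ with $S=\{s_1,\dots,s_n\}$ is called a Coxeter system. A relation with exponent $\infty$ is understood to be omitted. Graphs. A graph is a tuple $\Gamma=(V\sqcup E,\iota,\alpha,\omega)$ where $V,E$ are disjoint sets (vertices and edges), $\iota:V\sqcup E\to V\sqcup E$ and $\alpha,\omega:V\sqcup E\to V$ are maps with $V=\mathrm{Fix}(\iota)$, $\iota\circ\iota=\mathrm{id}$, $\alpha\circ\alpha=\alpha$, $\alpha\circ\iota=\omega$, and $\alpha(v)=\omega(v)=v$ for $v\in V$. Write $e^{-1}=\iota(e)$. Graphs are assumed to have no loops (edges $e$ with $\alpha(e)=\omega(e)$) and no multiple edges (distinct edges with the same $\alpha$ and the same $\omega$). A subgraph is given by a subset $U\subseteq V\sqcup E$ closed under $\iota,\alpha,\omega$, with the restricted maps. For $t\in\mathbb N$, a cycle of length $t$ is a subgraph with $U=\{v_i,e_i,e_i^{-1}\}_{i=1}^t$, $v_i\in V$, $e_i\in E$, such that $\omega(e_i)=\alpha(e_{i+1})=v_{i+1}$ for $1\le i<t$ and $\omega(e_t)=\alpha(e_1)=v_1$;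 it is denoted $[e_1,\dots,e_t]$. For $v\in V$, the subgraph on $\{v\}$ is a cycle of length zero, denoted $[v]$. $\mathrm{Cyc}(\Gamma)$ is the set of all cycles of all lengths. 2-complexes. A 2-complex is a tuple $K=(V\sqcup E\sqcup F,\iota,\alpha,\omega,\partial)$ where $\Gamma=(V\sqcup E,\iota,\alpha,\omega)$ is a graph, $F$ is a set (of 2-cells) disjoint from $V\sqcup E$, and $\partial:V\sqcup F\to\mathrm{Cyc}(\Gamma)$ is a map such that $\partial(x)$ has length zero if and only if $x\in V$, with $\partial(v)=[v]$ for $v\in V$. The boundary of every 2-cell is assumed to have length at least $3$, and distinct 2-cells have distinct boundaries. A weighted 2-complex is a pair $C=(K,\mu)$ with $K$ a 2-complex and $\mu:V\sqcup E\sqcup F\to\mathbb N\cup\{\infty\}$ such that $\mu(x)=1$ iff $x\in V$, and $\mu(x)=\infty$ implies $x\in E$. Generalized Coxeter group. For a weighted 2-complex $C$, $G(C)$ is the group with generating set $V$ and relations: $v^2=1$ for $v\in V$; $(\alpha(e)\omega(e))^{\mu(e)}=1$ for $e\in E$ (no relation if $\mu(e)=\infty$); $(\alpha(e_1)\cdots\alpha(e_t))^{\mu(f)}=1$ for each $f\in F$ with $\partial(f)=[e_1,\dots,e_t]$. *)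

(* Defs.v *)
From HB Require Import structures.
From mathcomp Require Import all_boot.
From mathcomp Require Import boolp classical_sets.

Set Implicit Arguments.
Unset Strict Implicit.
Unset Printing Implicit Defensive.

Local Open Scope classical_set_scope.
Local Open Scope group_scope.

(* The group given by a presentation <X | R>, for an arbitrary type X of
   generators: words in the letters x (encoded (x, false)) and x^-1 (encoded
   (x, true)), modulo the congruence generated by the cancellation of mutually
   inverse adjacent letters and by r ~ 1 for r in R. *)

Definition word (X : Type) : Type := seq ({classic X} * bool).

Definition letter (X : Type) (x : X) : word X := [:: (x : {classic X}, false)].

Definition wpow (X : Type) (w : word X) (k : nat) : word X :=
  iter k (cat w) [::].

Definition winv (X : Type) (w : word X) : word X :=
  rev [seq (a.1, ~~ a.2) | a <- w].

Inductive wequiv (X : Type) (R : set (word X)) : word X -> word X -> Prop :=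
| wequiv_refl u : wequiv R u u
| wequiv_sym u v : wequiv R u v -> wequiv R v u
| wequiv_trans u v w : wequiv R u v -> wequiv R v w -> wequiv R u w
| wequiv_cancel u v x b :
    wequiv R (u ++ [:: (x, b); (x, ~~ b)] ++ v) (u ++ v)
| wequiv_rel u v r : R r -> wequiv R (u ++ r ++ v) (u ++ v).

Section Presented.
Variables (X : Type) (R : set (word X)).

Definition wequivb (u v : word X) : bool := `[< wequiv R u v >].

Lemma wequivb_equiv : equiv_class_of wequivb.
Proof.
split=> [u|u v|u v w].
- exact/asboolP/wequiv_refl.
- by apply/asboolP/asboolP; apply: wequiv_sym.
- move=> /asboolP uv /asboolP vw.
  by apply/asboolP; apply: wequiv_trans uv vw.
Qed.

Canonical wequivb_rel := EquivRelPack wequivb_equiv.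

Definition presented : Type := {eq_quot wequivb_rel}%qT.
HB.instance Definition _ := Choice.on presented.

Definition pclass (u : word X) : presented := (\pi_({eq_quot wequivb_rel}) u)%qT.

Lemma pclassP (u v : word X) :
  pclass u = pclass v <-> wequiv R u v.
Proof.
split=> [/eqquotP/asboolP//|uv].
by apply/eqquotP/asboolP.
Qed.

Lemma wequiv_catl (w u v : word X) :
  wequiv R u v -> wequiv R (w ++ u) (w ++ v).
Proof.
elim=> {u v} [u|u v _|u v z _ uv _ vz|u v x b|u v r Rr].
- exact: wequiv_refl.
- exact: wequiv_sym.
- exact: wequiv_trans uv vz.
- by rewrite !(catA w); apply: wequiv_cancel.
- by rewrite !(catA w); apply: wequiv_rel.
Qed.

Lemma wequiv_catr (w u v : word X) :
  wequiv R u v -> wequiv R (u ++ w) (v ++ w).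
Proof.
elim=> {u v} [u|u v _|u v z _ uv _ vz|u v x b|u v r Rr].
- exact: wequiv_refl.
- exact: wequiv_sym.
- exact: wequiv_trans uv vz.
- by rewrite -!catA; apply: wequiv_cancel.
- by rewrite -!catA; apply: wequiv_rel.
Qed.

Lemma winvK : involutive (@winv X).
Proof.
move=> w; rewrite /winv map_rev revK -map_comp.
by rewrite (eq_map (g := id)) ?map_id// => -[x b] /=; rewrite negbK.
Qed.

Lemma wequiv_mulwV (w : word X) : wequiv R (w ++ winv w) [::].
Proof.
elim: w => [|[x b] w IHw]; first exact: wequiv_refl.
rewrite /winv /= rev_cons -cats1 catA -cat1s -catA.
apply: wequiv_trans (wequiv_cancel R [::] [::] x b).
have := wequiv_catl [:: (x, b)] (wequiv_catr [:: (x, ~~ b)] IHw).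
by rewrite -!catA.
Qed.

Lemma pclassK : cancel repr pclass.
Proof. exact: reprK. Qed.

Definition pone : presented := pclass [::].
Definition pmul (x y : presented) : presented :=
  pclass (repr x ++ repr y).
Definition pinv (x : presented) : presented := pclass (winv (repr x)).

Lemma repr_pclass (u : word X) : wequiv R (repr (pclass u)) u.
Proof. by apply/pclassP; rewrite pclassK. Qed.

Lemma pmul_pclass (u v : word X) :
  pmul (pclass u) (pclass v) = pclass (u ++ v).
Proof.
apply/pclassP; apply: wequiv_trans (wequiv_catl _ (repr_pclass v)).
exact/wequiv_catr/repr_pclass.
Qed.

Lemma pmulA : associative pmul.
Proof.
move=> x y z; rewrite -[x]pclassK -[y]pclassK -[z]pclassK.
by rewrite !pmul_pclass catA.
Qed.

Lemma p1mul : left_id pone pmul.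
Proof. by move=> x; rewrite -[x]pclassK pmul_pclass. Qed.

Lemma pmul1 : right_id pone pmul.
Proof. by move=> x; rewrite -[x]pclassK pmul_pclass cats0. Qed.

Lemma pmulV : right_inverse pone pinv pmul.
Proof.
move=> x; rewrite -{1}[x]pclassK pmul_pclass.
exact/pclassP/wequiv_mulwV.
Qed.

Lemma pVmul : left_inverse pone pinv pmul.
Proof.
move=> x; rewrite -{2}[x]pclassK pmul_pclass; apply/pclassP.
by rewrite -{2}[repr x]winvK; apply: wequiv_mulwV.
Qed.

HB.instance Definition _ :=
  isGroup.Build presented pmulA p1mul pmul1 pVmul pmulV.

Definition pgen (x : X) : presented := pclass (letter x).

End Presented.

Definition group_iso (G H : groupType) (f : G -> H) : Prop :=
  bijective f /\ {morph f : x y / x * y}.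

Definition isomorphic (G H : groupType) : Prop :=
  exists f : G -> H, group_iso f.

(* Exponents and weights in N u {oo} are elements of option nat: Some k for
   k >= 1 and None for oo. *)

Record coxeter_exponents (n : nat) (m : 'I_n -> 'I_n -> option nat) : Prop := {
  coxeter_diag : forall i, m i i = Some 1%N;
  coxeter_off_diag :
    forall i j, i <> j -> forall k, m i j = Some k -> (2 <= k)%N
}.

Inductive coxeter_relator (n : nat) (m : 'I_n -> 'I_n -> option nat) :
    word 'I_n -> Prop :=
| Coxeter_relator i j k : m i j = Some k ->
    coxeter_relator m (wpow (letter i ++ letter j) k).

(* m is not required to be symmetric. This does not enlarge the class of pairs
   (W, S): replacing m i j and m j i by their gcd, where
   gcd (k, oo) = k (and identifying s_i with s_j
   when it is 1) turns any such presentation into one with a symmetric m and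
   the same set S. *)
Definition coxeter_system (W : groupType) (S : set W) : Prop :=
  exists (n : nat) (m : 'I_n -> 'I_n -> option nat)
         (f : presented (coxeter_relator m) -> W),
    [/\ coxeter_exponents m, group_iso f
      & S = [set f (pgen (coxeter_relator m) i) | i in [set: 'I_n]]].

(* The disjoint union V u E is the sum type, V being the image of inl. *)
Record graph := Graph {
  gV : Type;
  gE : Type;
  iota : gV + gE -> gV + gE;
  alpha : gV + gE -> gV;
  omega : gV + gE -> gV;
  iota_fix : forall x, iota x = x <-> exists v, x = inl v;
  iotaK : forall x, iota (iota x) = x;
  alpha_alpha : forall x, alpha (inl (alpha x)) = alpha x;
  alpha_iota : forall x, alpha (iota x) = omega x;
  alpha_vertex : forall v, alpha (inl v) = v;
  omega_vertex : forall v, omega (inl v) = v;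
  graph_no_loop : forall e, alpha (inr e) <> omega (inr e);
  graph_no_multi : forall e e', alpha (inr e) = alpha (inr e') ->
    omega (inr e) = omega (inr e') -> e = e'
}.

Definition subgraph (Gamma : graph) (U : set (gV Gamma + gE Gamma)) : Prop :=
  forall x, U x -> [/\ U (iota x), U (inl (alpha x)) & U (inl (omega x))].

(* U = [e_1, ..., e_t] with t >= 1 and v_i = alpha (e_i); ordS is the cyclic
   successor on 'I_t. The v_i are distinct: otherwise the same U could be
   traversed with several values of t and would not have a length. *)
Record cycle_along (Gamma : graph) (U : set (gV Gamma + gE Gamma)) (t : nat)
    (e : 'I_t -> gE Gamma) : Prop := {
  cycle_pos : (0 < t)%N;
  cycle_subgraph : subgraph U;
  cycle_support : U = [set x | exists i, [\/ x = inl (alpha (inr (e i))),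
                                             x = inr (e i)
                                           | x = iota (inr (e i))]];
  cycle_consecutive :
    forall i, omega (inr (e i)) = alpha (inr (e (ordS i)));
  cycle_simple : injective (fun i => alpha (inr (e i)))
}.

Definition cycle_of_length (Gamma : graph) (U : set (gV Gamma + gE Gamma))
    (t : nat) : Prop :=
  if t is 0 then exists v, U = [set inl v]
  else exists e : 'I_t -> gE Gamma, cycle_along U e.

Definition Cyc (Gamma : graph) : set (set (gV Gamma + gE Gamma)) :=
  [set U | exists t, cycle_of_length U t].

Record two_complex := TwoComplex {
  skeleton :> graph;
  cF : Type;
  bd : gV skeleton + cF -> set (gV skeleton + gE skeleton);
  bd_Cyc : forall x, Cyc (bd x);
  bd_length0 : forall x, cycle_of_length (bd x) 0 <-> exists v, x = inl v;
  bd_vertex : forall v, bd (inl v) = [set inl v];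
  bd_length_ge3 :
    forall f t, cycle_of_length (bd (inr f)) t -> (3 <= t)%N;
  bd_cell_inj : forall f f', bd (inr f) = bd (inr f') -> f = f'
}.

Record weighted_two_complex := WeightedTwoComplex {
  complex :> two_complex;
  weight : gV complex + gE complex + cF complex -> option nat;
  weight_pos : forall x, weight x <> Some 0%N;
  weight_eq1 : forall x, weight x = Some 1%N <-> exists v, x = inl (inl v);
  weight_infty : forall x, weight x = None -> exists e, x = inl (inr e)
}.

(* A 2-cell contributes one relator for each way of writing its boundary as
   [e_1, ..., e_t]. These differ by the base point and the direction, hence are
   equivalent modulo the relations v^2 = 1. *)
Inductive complex_relator (C : weighted_two_complex) : word (gV C) -> Prop :=
| Vertex_relator (v : gV C) : complex_relator (wpow (letter v) 2)
| Edge_relator (e : gE C) (k : nat) : weight (inl (inr e)) = Some k ->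
    complex_relator
      (wpow (letter (alpha (inr e)) ++ letter (omega (inr e))) k)
| Cell_relator (f : cF C) (k t : nat) (e : 'I_t -> gE C) :
    weight (inr f) = Some k -> cycle_along (bd (inr f)) e ->
    complex_relator
      (wpow (flatten [seq letter (alpha (inr (e i))) | i <- enum 'I_t]) k).

Definition complex_group (C : weighted_two_complex) : groupType :=
  presented (@complex_relator C).

Definition generalized_coxeter_group (W : groupType) : Prop :=
  exists C : weighted_two_complex, isomorphic (complex_group C) W.

(* Main.v *)
Require Import Defs.
From mathcomp Require Import all_boot.
From mathcomp Require Import boolp classical_sets.

(** The complex has no 2-cells at all: its underlying graph is the complete
    graph on the set [S] of generators, and the edge joining [s] to [t] is
    weighted by the actual order, possibly infinite, of [s t] in [W].

    Working with the elements of [W] rather than with the indices of the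
    generators, and with orders rather than with the prescribed exponents,
    avoids two difficulties: different indices may name the same element (as
    the exponent matrix need not be symmetric, [m i j = 2] and [m j i = 3]
    force [s_i = s_j]), and a prescribed exponent is a priori only a multiple
    of the order.  All that is used of a Coxeter presentation is that its
    generators square to 1 and that each relator is a power of a product of
    two generators; any such presentation defines a generalized Coxeter group
    ([generalized_coxeter_presented]).

    The inclusion of [S] into [W] maps each relator of the complex to 1, by
    definition of the order.  Conversely, a relator [(x y)^k] of [W] becomes
    trivial in the group of the complex: if [x] and [y] name the same element
    it is a power of [v^2], and otherwise the order of [x y] divides [k], so it
    is a power of the relator of an edge.  The two resulting morphisms are
    mutually inverse because they are so on generators. *)

Set Implicit Arguments.
Unset Strict Implicit.
Unset Printing Implicit Defensive.

Local Open Scope classical_set_scope.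
Local Open Scope group_scope.

(** * Morphisms *)

Lemma morph1 (G H : groupType) (h : G -> H) :
  {morph h : x y / x * y} -> h 1 = 1.
Proof. by move=> hM; apply: (@mulIg _ (h 1)); rewrite -hM !mul1g. Qed.

Lemma morphVg (G H : groupType) (h : G -> H) :
  {morph h : x y / x * y} -> {morph h : x / x^-1}.
Proof.
by move=> hM x; apply: (@mulIg _ (h x)); rewrite -hM !mulVg (morph1 hM).
Qed.

Lemma isomorphic_trans (G H K : groupType) :
  isomorphic G H -> isomorphic H K -> isomorphic G K.
Proof.
move=> [f [fB fM]] [g [gB gM]]; exists (g \o f); split; first exact: bij_comp.
by move=> x y /=; rewrite fM gM.
Qed.

(** * The universal property of a presented group *)

Definition weval (X : Type) (H : groupType) (g : X -> H) (w : word X) : H :=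
  \prod_(a <- w) (if a.2 then (g a.1)^-1 else g a.1).

Lemma weval_cat (X : Type) (H : groupType) (g : X -> H) (u v : word X) :
  weval g (u ++ v) = weval g u * weval g v.
Proof. exact: big_cat. Qed.

Lemma weval_letter (X : Type) (H : groupType) (g : X -> H) (x : X) :
  weval g (letter x) = g x.
Proof. by rewrite /weval /letter big_seq1. Qed.

Lemma weval_wpow (X : Type) (H : groupType) (g : X -> H) (w : word X) k :
  weval g (wpow w k) = weval g w ^+ k.
Proof.
elim: k => [|k IHk]; first by rewrite /weval /= big_nil.
by rewrite /wpow iterS weval_cat -/(wpow w k) IHk expgS.
Qed.

Lemma weval_wpow2 (X : Type) (H : groupType) (g : X -> H) (x y : X) k :
  weval g (wpow (letter x ++ letter y) k) = (g x * g y) ^+ k.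
Proof. by rewrite weval_wpow weval_cat !weval_letter. Qed.

Lemma weval_wequiv (X : Type) (R : set (word X)) (H : groupType) (g : X -> H) :
    (forall r, R r -> weval g r = 1) ->
  forall u v, wequiv R u v -> weval g u = weval g v.
Proof.
move=> gR u v; elim=> {u v} // [u v w _ -> _ ->//|u v x b|u v r Rr].
- rewrite !weval_cat; congr (_ * _); rewrite -[RHS]mul1g; congr (_ * _).
  rewrite /weval big_cons big_seq1 /=.
  by case: b; rewrite ?mulgV ?mulVg.
- by rewrite !weval_cat (gR r)// mul1g.
Qed.

Lemma pclass_cat (X : Type) (R : set (word X)) (u v : word X) :
  pclass R (u ++ v) = pclass R u * pclass R v.
Proof. by rewrite -[RHS]/(pmul _ _) pmul_pclass. Qed.

Lemma pclass_letterV (X : Type) (R : set (word X)) (x : X) :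
  pclass R [:: (x : {classic X}, true)] = (pgen R x)^-1.
Proof.
apply: (@mulIg _ (pgen R x)); rewrite mulVg -pclass_cat.
exact/pclassP/(wequiv_cancel R [::] [::] x true).
Qed.

Lemma morph_pclass (X : Type) (R : set (word X)) (H : groupType)
    (h : presented R -> H) (hM : {morph h : x y / x * y}) (w : word X) :
  h (pclass R w) = weval (h \o pgen R) w.
Proof.
elim: w => [|[x b] w IHw]; first by rewrite /weval big_nil -[RHS](morph1 hM).
rewrite -cat1s pclass_cat hM weval_cat IHw; congr (_ * _).
rewrite /weval big_seq1 /=.
by case: b => //; rewrite pclass_letterV morphVg.
Qed.

Lemma weval_pgen (X : Type) (R : set (word X)) (w : word X) :
  weval (pgen R) w = pclass R w.
Proof. by apply/esym/(@morph_pclass _ R _ id). Qed.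

Lemma pclass_relator (X : Type) (R : set (word X)) (r : word X) :
  R r -> pclass R r = 1.
Proof.
by move=> Rr; apply/pclassP; have := wequiv_rel [::] [::] Rr; rewrite cats0.
Qed.

Lemma eq_presented_morph (X : Type) (R : set (word X)) (H : groupType)
    (h h' : presented R -> H) :
    {morph h : x y / x * y} -> {morph h' : x y / x * y} ->
  (forall x, h (pgen R x) = h' (pgen R x)) -> h =1 h'.
Proof.
move=> hM h'M hh' x; rewrite -[x]pclassK !morph_pclass//.
by rewrite (_ : h \o pgen R = h' \o pgen R)//; apply: funext.
Qed.

Definition plift (X : Type) (R : set (word X)) (H : groupType) (g : X -> H)
  (x : presented R) : H := weval g (repr x).

Lemma plift_pclass (X : Type) (R : set (word X)) (H : groupType) (g : X -> H)
    (gR : forall r, R r -> weval g r = 1) (w : word X) :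
  plift g (pclass R w) = weval g w.
Proof. exact/(weval_wequiv gR)/repr_pclass. Qed.

Lemma plift_pgen (X : Type) (R : set (word X)) (H : groupType) (g : X -> H)
    (gR : forall r, R r -> weval g r = 1) (x : X) :
  plift g (pgen R x) = g x.
Proof. by rewrite plift_pclass// weval_letter. Qed.

Lemma plift_morph (X : Type) (R : set (word X)) (H : groupType) (g : X -> H)
    (gR : forall r, R r -> weval g r = 1) :
  {morph @plift X R H g : x y / x * y}.
Proof.
move=> x y; rewrite -[x]pclassK -[y]pclassK -pclass_cat.
by rewrite !plift_pclass// weval_cat.
Qed.

(** * Orders of elements *)

Definition elt_order (G : groupType) (x : G) : option nat :=
  if pselect (exists k, (0 < k)%N && (x ^+ k == 1)) is left x_tors
  then Some (ex_minn x_tors) else None.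

Lemma elt_orderP (G : groupType) (x : G) d :
  elt_order x = Some d -> (0 < d)%N /\ x ^+ d = 1.
Proof.
rewrite /elt_order; case: pselect => // x_tors [<-].
by case: ex_minnP => k /andP[k_gt0 /eqP xk] _.
Qed.

Lemma elt_order_dvd (G : groupType) (x : G) k : (0 < k)%N -> x ^+ k = 1 ->
  exists2 d, elt_order x = Some d & (d %| k)%N.
Proof.
move=> k_gt0 xk; rewrite /elt_order; case: pselect => [x_tors|[]]; last first.
  by exists k; rewrite k_gt0 xk eqxx.
exists (ex_minn x_tors) => //; case: ex_minnP => d /andP[d_gt0 /eqP xd] d_min.
have xmod : x ^+ (k %% d) = 1.
  by rewrite -xk [in RHS](divn_eq k d) expgnDr mulnC expgnA xd expg1n mul1g.
rewrite /dvdn; case: posnP => // mod_gt0.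
have := d_min (k %% d)%N; rewrite mod_gt0 xmod eqxx => /(_ isT).
by rewrite leqNgt ltn_pmod.
Qed.

(** * The complex of a set of involutions *)

Definition distinct_pair (V : Type) : Type := {p : V * V | p.1 <> p.2}.

Definition swap_pair (V : Type) (e : distinct_pair V) : distinct_pair V :=
  exist (fun p : V * V => p.1 <> p.2) ((sval e).2, (sval e).1)
    (fun eq21 => svalP e (esym eq21)).

Lemma distinct_pair_inj (V : Type) (e e' : distinct_pair V) :
  (sval e).1 = (sval e').1 -> (sval e).2 = (sval e').2 -> e = e'.
Proof.
case: e e' => [[x y] xy] [[x' y'] xy'] /= eqx eqy.
by apply: eq_exist; congr pair.
Qed.

Definition complete_iota (V : Type) (x : V + distinct_pair V) :=
  match x with inl v => inl v | inr e => inr (swap_pair e) end.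

Definition complete_alpha (V : Type) (x : V + distinct_pair V) :=
  match x with inl v => v | inr e => (sval e).1 end.

Definition complete_omega (V : Type) (x : V + distinct_pair V) :=
  match x with inl v => v | inr e => (sval e).2 end.

Lemma complete_iota_fix (V : Type) (x : V + distinct_pair V) :
  complete_iota x = x <-> exists v, x = inl v.
Proof.
split=> [|[v ->]//]; case: x => [v _|e /= [eq_e]]; first by exists v.
by case: (svalP e); rewrite -[in LHS]eq_e.
Qed.

Lemma complete_iotaK (V : Type) : involutive (@complete_iota V).
Proof. by case=> //= e; congr inr; apply: distinct_pair_inj. Qed.

Definition complete_graph (V : Type) : graph :=
  @Graph V (distinct_pair V) (@complete_iota V) (@complete_alpha V)
    (@complete_omega V) (@complete_iota_fix V) (@complete_iotaK V)
    (fun _ => erefl)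
    (fun x => match x with inl _ => erefl | inr _ => erefl end)
    (fun _ => erefl) (fun _ => erefl)
    (fun e => svalP e) (@distinct_pair_inj V).

Definition one_complex_bd (Gamma : graph) (x : gV Gamma + void) :
    set (gV Gamma + gE Gamma) :=
  match x with inl v => [set inl v] | inr f => match f with end end.

Lemma one_complex_length0 (Gamma : graph) (x : gV Gamma + void) :
  cycle_of_length (one_complex_bd x) 0 <-> exists v, x = inl v.
Proof. by case: x => [v|[]]; split=> _; exists v. Qed.

Definition one_complex (Gamma : graph) : two_complex :=
  @TwoComplex Gamma void (@one_complex_bd Gamma)
    (fun x => ex_intro _ 0%N (match x return cycle_of_length (one_complex_bd x) 0
       with inl v => ex_intro _ v erefl | inr f => match f with end end))
    (@one_complex_length0 Gamma) (fun _ => erefl)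
    (fun f => match f with end) (fun f => match f with end).

Definition order_weight (G : groupType) (S : set G)
    (x : {s | S s} + distinct_pair {s | S s} + void) : option nat :=
  match x with
  | inl (inl _) => Some 1%N
  | inl (inr e) => elt_order (sval (sval e).1 * sval (sval e).2)
  | inr f => match f with end
  end.

Lemma order_weight_pos (G : groupType) (S : set G)
    (x : {s | S s} + distinct_pair {s | S s} + void) :
  order_weight x <> Some 0%N.
Proof. by case: x => [[v|e]|[]]//= /elt_orderP[]. Qed.

(** An edge never has weight 1: for distinct involutions [s] and [t],
    [s t = 1] would give [t = s^-1 = s]. *)
Lemma order_weight_eq1 (G : groupType) (S : set G)
    (S_inv : forall s, S s -> s * s = 1)
    (x : {s | S s} + distinct_pair {s | S s} + void) :
  order_weight x = Some 1%N <-> exists v, x = inl (inl v).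
Proof.
split=> [|[v ->]//].
case: x => [[v|[[[s Ss] [t St]] /= st]]|[]]; first by exists v.
move=> /elt_orderP[_]; rewrite expg1 => st1; case: st; apply: eq_exist.
by apply: (@mulgI _ s); rewrite st1 S_inv.
Qed.

Lemma order_weight_infty (G : groupType) (S : set G)
    (x : {s | S s} + distinct_pair {s | S s} + void) :
  order_weight x = None -> exists e, x = inl (inr e).
Proof. by case: x => [[v|e]|[]]// _; exists e. Qed.

Definition order_complex (G : groupType) (S : set G)
    (S_inv : forall s, S s -> s * s = 1) : weighted_two_complex :=
  @WeightedTwoComplex (one_complex (complete_graph {s | S s}))
    (@order_weight G S) (@order_weight_pos G S) (order_weight_eq1 S_inv)
    (@order_weight_infty G S).

Lemma order_complex_relator (G : groupType) (S : set G)
    (S_inv : forall s, S s -> s * s = 1) (r : word {s | S s}) :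
  @complex_relator (order_complex S_inv) r -> weval sval r = 1.
Proof.
case=> [v|e k|[]].
  by rewrite weval_wpow weval_letter; apply: S_inv (svalP v).
by move=> /elt_orderP[_ ek]; rewrite weval_wpow2.
Qed.

(** The edge joining distinct [s] and [t] carries the order [d] of [s t], and
    [d] divides [k], so that its single relator [(s t)^d] suffices.  When
    [s = t] there is no edge, and the vertex relator does the work. *)
Lemma order_complex_pow (G : groupType) (S : set G)
    (S_inv : forall s, S s -> s * s = 1) (s t : {s | S s}) k :
    (0 < k)%N -> (sval s * sval t) ^+ k = 1 ->
  let v := pgen (@complex_relator (order_complex S_inv)) in
  (v s * v t) ^+ k = 1.
Proof.
move=> k_gt0 stk v; have [<-|st] := pselect (s = t).
  suff -> : v s * v s = 1 by rewrite expg1n.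
  have := pclass_relator (@Vertex_relator (order_complex S_inv) s).
  by rewrite -weval_pgen weval_wpow weval_letter.
have [d ord_st /dvdnP[q ->]] := elt_order_dvd k_gt0 stk.
pose e : distinct_pair {s | S s} := exist _ (s, t) st.
have := pclass_relator (@Edge_relator (order_complex S_inv) e d ord_st).
by rewrite -weval_pgen weval_wpow2 mulnC expgnA => ->; rewrite expg1n.
Qed.

(** * Groups presented by involutions and powers of pairs *)

(** The vertices are the distinct elements named by the generators, so that
    [vertex] need not be injective; it is still enough to compare morphisms on
    generators because every vertex is some [vertex x]. *)
Lemma generalized_coxeter_presented (X : Type) (R : set (word X)) :
    (forall x, pgen R x * pgen R x = 1) ->
    (forall r, R r ->
       exists x y k, (0 < k)%N /\ r = wpow (letter x ++ letter y) k) ->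
  generalized_coxeter_group (presented R).
Proof.
move=> X_inv R_pow; pose S := range (pgen R).
have S_inv s : S s -> s * s = 1 by case=> x _ <-.
pose C := order_complex S_inv; exists C.
pose RC : set (word {s | S s}) := @complex_relator C.
pose vertex x : {s | S s} := exist S (pgen R x) (imageT (pgen R) x).
have RC1 r : RC r -> weval sval r = 1 by apply: order_complex_relator.
have R1 r : R r -> weval (pgen RC \o vertex) r = 1.
  move=> Rr; have [x [y [k [k_gt0 defr]]]] := R_pow r Rr.
  rewrite defr weval_wpow2; apply: order_complex_pow => //=.
  by rewrite -weval_wpow2 -defr weval_pgen pclass_relator.
pose f : presented RC -> presented R := plift sval.
pose g : presented R -> presented RC := plift (pgen RC \o vertex).
have fM : {morph f : x y / x * y} := plift_morph RC1.
have gM : {morph g : x y / x * y} := plift_morph R1.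
have fgen v : f (pgen RC v) = sval v := plift_pgen RC1 v.
have ggen x : g (pgen R x) = pgen RC (vertex x) := plift_pgen R1 x.
exists f; split=> //; exists g.
- apply: (eq_presented_morph (h := g \o f) (h' := id)) => //.
    by move=> x y /=; rewrite fM gM.
  move=> [s Ss] /=; rewrite fgen /=; have [x _ defs] := Ss.
  by rewrite -[in LHS]defs ggen; congr (pgen RC _); apply: eq_exist.
- apply: (eq_presented_morph (h := f \o g) (h' := id)) => //.
    by move=> x y /=; rewrite gM fM.
  by move=> x; rewrite /= ggen fgen.
Qed.

Theorem proposition10 (W : groupType) (S : set W) (hS : coxeter_system S) :
  generalized_coxeter_group W.
Proof.
have [n [m [f [[m_diag m_off] f_iso _]]]] := hS.
have [|r [i j k mij]|C C_iso] :=
  @generalized_coxeter_presented _ (coxeter_relator m).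
- move=> i; have /pclass_relator := Coxeter_relator (m_diag i).
  by rewrite -weval_pgen weval_wpow2 expg1.
- exists i, j, k; split=> //; have [eq_ij|/m_off/(_ k mij)] := pselect (i = j).
    by move: mij; rewrite eq_ij m_diag => -[<-].
  exact: ltnW.
- by exists C; apply: isomorphic_trans C_iso _; exists f.
Qed.
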